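(* Let $q$ be a prime power, let $n$ be a positive integer, and consider sets $S_i\subseteq\mathbb{F}_q^\ast$, $i=1,\ldots,n$. Write $s_i=|S_i|$ and assume $0<s_i<q-1$ for $i=1,\ldots,n$, with not all $s_i$ equal to $q-2$. Define $T_i=\mathbb{F}_q^\ast\setminus S_i$, $t_i=|T_i|$ and $m=\prod_{i=1}^n t_i$. Consider $$P(\vec{X})=\prod_{i=1}^n\prod_{x\in S_i}(X_i-x)\in\mathbb{F}_q[X_1,\ldots,X_n].$$ There exists a monomial $X_1^{k_1}\cdots X_n^{k_n}$ with $0<k_1,\ldots,k_n<q-1$ such that $$\operatorname{Supp}\big(X_1^{k_1}\cdots X_n^{k_n}P(\vec{X}) \bmod \{X_1^{q-1}-1,\ldots,X_n^{q-1}-1\}\big)\cap U(q,m-1,n)=\emptyset$$ if and only if for every $i=1,\ldots,n$ the set $T_i$ is contained in $\gamma_iH_i$ for some $\gamma_i\in\mathbb{F}_q^\ast$ and some proper multiplicative subgroup $H_i$ of $\mathbb{F}_q^\ast$.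
   Context: $\mathbb{F}_q$ is the finite field with $q$ elements, $\mathbb{F}_q^\ast=\mathbb{F}_q\setminus\{0\}$ and $\vec{X}=(X_1,\ldots,X_n)$. For a polynomial $F$, $\operatorname{Supp}(F)$ is the set of monomials occurring in $F$ with nonzero coefficient. For $F\in\mathbb{F}_q[X_1,\ldots,X_n]$, $F \bmod \{X_1^{q-1}-1,\ldots,X_n^{q-1}-1\}$ denotes the unique polynomial of degree less than $q-1$ in each variable that is congruent to $F$ modulo the ideal generated by $X_1^{q-1}-1,\ldots,X_n^{q-1}-1$ (i.e. exponents are reduced modulo $q-1$ into $\{0,\ldots,q-2\}$). For positive integers $m$ and $n$ define $$\mathcal{M}(q,n)=\{X_1^{i_1}\cdots X_n^{i_n}\mid 0\le i_1,\ldots,i_n<q-1\},$$ $$U(q,m,n)=\Big\{X_1^{i_1}\cdots X_n^{i_n}\in\mathcal{M}(q,n)\ \Big|\ \prod_{s=1}^n(q-1-i_s)\le m\Big\}.$$ (The assumptions on the $s_i$ give $m\ge 2$ in the theorem, so $U(q,m-1,n)$ is defined.) *)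

(* Defs.v *)
From HB Require Import structures.
From mathcomp Require Export all_boot all_order all_algebra all_fingroup all_field.
From mathcomp Require Import ssrcomplements.
From mathcomp Require Export mpoly.

Set Implicit Arguments.
Unset Strict Implicit.
Unset Printing Implicit Defensive.

Import GRing.Theory.
Local Open Scope ring_scope.

(* Monomials are identified with their exponent vectors in 'X_{1..n}. *)

Definition Mmon (q n : nat) : pred 'X_{1..n} :=
  [pred mu : 'X_{1..n} | [forall i : 'I_n, (mu i < q - 1)%N]].

Definition Umon (q m n : nat) : pred 'X_{1..n} :=
  [pred mu : 'X_{1..n} |
    Mmon q mu && (\prod_(s < n) (q - 1 - mu s) <= m)%N].

Definition mnm_red (q n : nat) (mu : 'X_{1..n}) : 'X_{1..n} :=
  [multinom (mu i %% (q - 1))%N | i < n].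

(* The remainder modulo {X_1^(q-1) - 1, ..., X_n^(q-1) - 1}; see mpoly_redP for
   its characterization as the unique reduced representative. *)
Definition mpoly_red (q n : nat) (R : nzRingType) (p : {mpoly R[n]}) :
    {mpoly R[n]} :=
  \sum_(mu <- msupp p) p@_mu *: 'X_[mnm_red q mu].

Section MpolyRed.

Variables (q n : nat) (R : comNzRingType).
Implicit Types (p r : {mpoly R[n]}) (mu nu : 'X_{1..n}).

Definition congr_mod p r : Prop :=
  exists c : 'I_n -> {mpoly R[n]},
    p - r = \sum_(i < n) c i * ('X_i ^+ (q - 1) - 1).

Lemma congr_mod_refl p : congr_mod p p.
Proof.
by exists (fun=> 0); rewrite subrr big1 // => i _; rewrite mul0r.
Qed.

Lemma congr_modD p p' r r' :
  congr_mod p r -> congr_mod p' r' -> congr_mod (p + p') (r + r').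
Proof.
move=> [c Ec] [c' Ec']; exists (fun i => c i + c' i).
rewrite opprD addrACA Ec Ec' -big_split /=.
by apply: eq_bigr => i _; rewrite mulrDl.
Qed.

Lemma congr_modMl a p r : congr_mod p r -> congr_mod (a * p) (a * r).
Proof.
move=> [c Ec]; exists (fun i => a * c i).
by rewrite -mulrBr Ec mulr_sumr; apply: eq_bigr => i _; rewrite mulrA.
Qed.

Lemma congr_mod_trans p r s : congr_mod p r -> congr_mod r s -> congr_mod p s.
Proof.
move=> [c Ec] [c' Ec']; exists (fun i => c i + c' i).
rewrite -(subrK r p) -addrA Ec Ec' -big_split /=.
by apply: eq_bigr => i _; rewrite mulrDl.
Qed.

Lemma congr_modM p p' r r' :
  congr_mod p r -> congr_mod p' r' -> congr_mod (p * p') (r * r').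
Proof.
move=> h h'; apply: congr_mod_trans (congr_modMl p h') _.
by rewrite ![_ * r']mulrC; apply: congr_modMl.
Qed.

Lemma congr_mod_var (i : 'I_n) (k : nat) :
  congr_mod ('X_i ^+ k) ('X_i ^+ (k %% (q - 1))).
Proof.
have Xd1 : congr_mod ('X_i ^+ (q - 1)) 1.
  exists (fun j => (j == i)%:R); rewrite (bigD1 i) //= eqxx mul1r.
  by rewrite big1 ?addr0 // => j /negbTE ->; rewrite mul0r.
rewrite {1}(divn_eq k (q - 1)) exprD -[X in congr_mod _ X]mul1r mulnC exprM.
apply: congr_modM; last exact: congr_mod_refl.
elim: (k %/ _)%N => [|e IHe]; first by rewrite expr0; apply: congr_mod_refl.
by rewrite exprS -[X in congr_mod _ X]mul1r; apply: congr_modM.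
Qed.

Lemma congr_mod_mnm mu : congr_mod 'X_[mu] 'X_[mnm_red q mu].
Proof.
rewrite !mpolyXE_id; apply: (big_ind2 congr_mod).
- exact: congr_mod_refl.
- by move=> p r p' r'; apply: congr_modM.
- by move=> i _; rewrite mnmE; apply: congr_mod_var.
Qed.

Lemma mpoly_redwE k p : (msize p <= k)%N ->
  mpoly_red q p = \sum_(mu : 'X_{1..n < k}) p@_mu *: 'X_[mnm_red q mu].
Proof.
move=> le_pk; pose I : subFinType _ := 'X_{1..n < k}.
rewrite /mpoly_red (big_mksub I) //=; first last.
- by move=> x /msize_mdeg_lt /leq_trans; apply.
- by rewrite msupp_uniq.
by rewrite big_rmcond //= => i /memN_msupp_eq0 ->; rewrite scale0r.
Qed.

Fact mpoly_red_is_linear : linear (@mpoly_red q n R).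
Proof.
move=> a p r; pose k := maxn (msize (a *: p + r)) (maxn (msize p) (msize r)).
rewrite !(@mpoly_redwE k) ?leq_max ?leqnn ?orbT // scaler_sumr -big_split /=.
by apply: eq_bigr => mu _; rewrite mcoeffD mcoeffZ scalerDl scalerA.
Qed.

HB.instance Definition _ :=
  GRing.isLinear.Build R {mpoly R[n]} {mpoly R[n]} _ (@mpoly_red q n R)
    mpoly_red_is_linear.

Lemma mpoly_redX mu : mpoly_red q 'X_[mu] = 'X_[mnm_red q mu] :> {mpoly R[n]}.
Proof. by rewrite /mpoly_red msuppX big_seq1 mcoeffX eqxx scale1r. Qed.

Lemma mpoly_red_kill (c : {mpoly R[n]}) (i : 'I_n) :
  mpoly_red q (c * ('X_i ^+ (q - 1) - 1)) = 0.
Proof.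
rewrite mulrBr mulr1 raddfB /=; apply/eqP; rewrite subr_eq0; apply/eqP.
rewrite {1 2}[c]mpolyE mulr_suml !raddf_sum /=; apply: eq_bigr => mu _.
rewrite -scalerAl !linearZ /=; congr (_ *: _).
rewrite mpolyXn -mpolyXD !mpoly_redX; congr ('X_[_]); apply/mnmP => j.
rewrite !mnmE mulmnE mnm1E; case: (i == j); first by rewrite mul1n modnDr.
by rewrite mul0n addn0.
Qed.

Lemma mpoly_red_id r : {subset msupp r <= Mmon q (n := n)} -> mpoly_red q r = r.
Proof.
move=> red_r; rewrite [RHS]mpolyE /mpoly_red !big_seq.
apply: eq_bigr => mu /red_r /forallP lt_mu; congr (_ *: 'X_[_]).
by apply/mnmP => i; rewrite mnmE modn_small.
Qed.

Lemma mpoly_redP p r : (1 < q)%N ->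
  {subset msupp r <= Mmon q (n := n)} /\ congr_mod p r <-> r = mpoly_red q p.
Proof.
move=> q_gt1; split=> [[red_r [c Ec]]|->].
  have: mpoly_red q (p - r) = 0.
    by rewrite Ec raddf_sum big1 // => i _; apply: mpoly_red_kill.
  by rewrite raddfB /= (mpoly_red_id red_r) => /eqP; rewrite subr_eq0 => /eqP.
split=> [mu|].
  apply: contraLR => nred_mu; rewrite mcoeff_msupp negbK /mpoly_red.
  rewrite raddf_sum big1 //= => nu _; rewrite mcoeffZ mcoeffX.
  case: eqP => [E|_]; last by rewrite mulr0.
  case/negP: nred_mu; rewrite -E; apply/forallP => i.
  by rewrite mnmE ltn_mod subn_gt0.
rewrite {1}[p]mpolyE /mpoly_red; apply: (big_ind2 congr_mod).
- exact: congr_mod_refl.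
- by move=> ? ? ? ?; apply: congr_modD.
- move=> mu _; rewrite -!mul_mpolyC; apply: congr_modMl; exact: congr_mod_mnm.
Qed.

End MpolyRed.

(* Main.v *)
(* Modulo the [X_i^(q-1) - 1] the polynomial splits as a product of univariate
   shifts [Q_i = X^(k_i) P_i mod (X^(q-1) - 1)], so its support is the product
   of the supports of the [Q_i], and the product of the [q - 1 - i_s] is least
   at the degrees of the [Q_i].  As [Q_i] is nonzero and vanishes on [S_i],
   [q - 1 - deg Q_i <= t_i]; hence the support avoids [U(q,m-1,n)] iff each
   [Q_i] has degree [s_i], i.e. is a scalar multiple of [P_i].  This says that
   [x^(k_i)] is constant on [T_i], i.e. [T_i] lies in a coset of the group of
   [k_i]-th roots of unity, which is proper because [0 < k_i < q - 1]. *)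

Require Import Defs.
From mathcomp Require Import cyclic.
Import GRing.Theory.
Local Open Scope ring_scope.

(** * Products of univariate polynomials in separate variables, and their reduction *)

Lemma size_modp_Xn_sub_1 (F : fieldType) (N : nat) (p : {poly F}) :
  (0 < N)%N -> (size (p %% ('X^N - 1))%R <= N)%N.
Proof.
move=> N_gt0; rewrite -ltnS -(size_Xn_sub_1 F N_gt0) ltn_modpN0 //.
by rewrite -size_poly_gt0 size_Xn_sub_1.
Qed.

(** The factors use distinct variables, so expanding the product yields each monomial from exactly
    one choice of exponents. *)
Lemma mcoeff_prod_horner_alg (R : comNzRingType) (n : nat)
    (Q : 'I_n -> {poly R}) (mu : 'X_{1..n}) :
  (\prod_(i < n) horner_alg ('X_i : {mpoly R[n]}) (Q i))@_mu =
    \prod_(i < n) (Q i)`_(mu i).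
Proof.
(* A common bound on all sizes and on all [mu i]: every factor becomes a sum over ['I_K], and [mu]
   is itself one of the choices of exponents. *)
pose K := (\max_(i < n) maxn (size (Q i)) (mu i).+1)%N.
have leK i : (maxn (size (Q i)) (mu i).+1 <= K)%N.
  exact: (leq_bigmax_cond (F := fun i => maxn (size (Q i)) (mu i).+1)).
have QE i : horner_alg ('X_i : {mpoly R[n]}) (Q i) =
    \sum_(j < K) (Q i)`_j *: 'X_i ^+ j.
  rewrite -[in LHS](coefK (Q i)) poly_def raddf_sum /=.
  rewrite (big_ord_widen K (fun j => horner_alg 'X_i ((Q i)`_j *: 'X^j))) /=;
    last exact: leq_trans (leq_maxl _ _) (leK i).
  rewrite big_mkcond; apply: eq_bigr => j _.
  case: ltnP => [_|le_Qj]; last by rewrite nth_default // scale0r.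
  by rewrite linearZ rmorphXn /= horner_algX mulr_algl.
rewrite (eq_bigr _ (fun i _ => QE i)) bigA_distr_bigA /= raddf_sum /=.
have mu_lt i : (mu i < K)%N by exact: leq_trans (leq_maxr _ _) (leK i).
have termE (f : {ffun 'I_n -> 'I_K}) :
    \prod_(i < n) ((Q i)`_(f i) *: 'X_i ^+ f i) =
    \prod_(i < n) (Q i)`_(f i) *: 'X_[[multinom f i : nat | i < n]]
      :> {mpoly R[n]}.
  rewrite scaler_prod mpolyXE_id; congr (_ *: _).
  by apply: eq_bigr => i _; rewrite mnmE.
pose f0 : {ffun 'I_n -> 'I_K} := [ffun i => Ordinal (mu_lt i)].
rewrite (bigD1 f0) //= [X in _ + X]big1 ?addr0 => [|f ne_f].
  rewrite termE mcoeffZ mcoeffX.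
  rewrite (_ : [multinom _ | _ < _] = mu) ?eqxx ?mulr1.
    by apply: eq_bigr => i _; rewrite ffunE.
  by apply/mnmP => i; rewrite mnmE ffunE.
rewrite termE mcoeffZ mcoeffX; case: eqP => [fE|]; last by rewrite mulr0.
case/eqP: ne_f; apply/ffunP => i; apply: val_inj.
by rewrite ffunE /= -fE mnmE.
Qed.

Lemma congr_mod_prod (q n : nat) (R : comNzRingType)
    (p r : 'I_n -> {mpoly R[n]}) :
  (forall i, congr_mod q (p i) (r i)) ->
  congr_mod q (\prod_(i < n) p i) (\prod_(i < n) r i).
Proof.
move=> pr; apply: (big_ind2 (@congr_mod q n R)) => //.
  exact: congr_mod_refl.
by move=> *; apply: congr_modM.
Qed.

Lemma congr_mod_modp (q n : nat) (F : fieldType) (i : 'I_n) (p : {poly F}) :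
  congr_mod q (horner_alg ('X_i : {mpoly F[n]}) p)
              (horner_alg 'X_i (p %% ('X^(q - 1) - 1))).
Proof.
exists (fun j => (j == i)%:R * horner_alg 'X_i (p %/ ('X^(q - 1) - 1))).
rewrite (bigD1 i) //= eqxx mul1r big1 ?addr0 => [|j /negbTE ->]; last first.
  by rewrite !mul0r.
rewrite {1}(divp_eq p ('X^(q - 1) - 1)) rmorphD addrK rmorphM /= rmorphB.
by rewrite rmorphXn rmorph1 /= horner_algX.
Qed.

(** The product of the univariate remainders is already reduced, so uniqueness of the reduced
    representative applies to it. *)
Lemma mcoeff_mpoly_red_prod (q n : nat) (F : fieldType)
    (p : 'I_n -> {poly F}) (mu : 'X_{1..n}) : (1 < q)%N ->
  (mpoly_red q (\prod_(i < n) horner_alg ('X_i : {mpoly F[n]}) (p i)))@_mu =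
    \prod_(i < n) (p i %% ('X^(q - 1) - 1))`_(mu i).
Proof.
move=> q_gt1; rewrite -mcoeff_prod_horner_alg; congr (_@_mu); symmetry.
apply/mpoly_redP => //; split; last first.
  by apply: congr_mod_prod => i; apply: congr_mod_modp.
move=> nu; rewrite mcoeff_msupp mcoeff_prod_horner_alg => /prodf_neq0 nz.
apply/forallP => i; rewrite ltnNge; apply: contraT; rewrite negbK => le_i.
have/eqP[] := nz i isT; rewrite nth_default // (leq_trans _ le_i) //.
by rewrite size_modp_Xn_sub_1 // subn_gt0.
Qed.

(** * The univariate shift and its degree *)

Section Univariate.

Variables (F : finFieldType) (S : {set F}) (k : nat).
Hypotheses (S0 : 0 \notin S) (S_lt : (#|S| < #|F| - 1)%N).

Let T := [set~ 0] :\: S.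
Let N := (#|F| - 1)%N.
Let P := \prod_(x in S) ('X - x%:P).
Let Q := ('X^k * P) %% ('X^N - 1).

Let N_gt0 : (0 < N)%N. Proof. exact: leq_ltn_trans S_lt. Qed.

Let size_Q : (size Q <= N)%N.
Proof. exact: size_modp_Xn_sub_1. Qed.

Let size_P : size P = #|S|.+1.
Proof. by rewrite /P -big_enum size_prod_XsubC -cardE. Qed.

Let root_P x : (P.[x] == 0) = (x \in S).
Proof.
by rewrite -[_ == 0]/(root P x) /P -big_enum root_prod_XsubC mem_enum.
Qed.

(** Nonzero elements are roots of ['X^N - 1], so the reduction keeps the values there. *)
Let horner_Q x : x != 0 -> Q.[x] = x ^+ k * P.[x].
Proof.
move=> x0; have xN : x ^+ N = 1.
  apply: (mulfI x0); rewrite -exprS /N subn1 prednK ?expf_card ?mulr1 //.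
  by apply/card_gt0P; exists 0.
have := congr1 (horner^~ x) (divp_eq ('X^k * P) ('X^N - 1)).
by rewrite !hornerE xN subrr mulr0 add0r => <-.
Qed.

Let poly_eq0 (p : {poly F}) :
  (size p <= N)%N -> (forall x, x != 0 -> p.[x] = 0) -> p = 0.
Proof.
move=> le_p p0; apply/eqP; apply: contraT => nz_p.
have := @max_poly_roots F p (enum [set~ (0 : F)]) nz_p.
rewrite enum_uniq -cardE cardsC1 -subn1 -/N ltnNge le_p => /(_ _ isT) H.
apply: H; apply/allP => x; rewrite mem_enum !inE => x0.
by rewrite /root p0.
Qed.

Let in_T x : (x \in T) = (x \notin S) && (x != 0).
Proof. by rewrite !inE. Qed.

Lemma card_nz_setD : (#|T| + #|S| = N)%N.
Proof.
rewrite /N subn1 -(cardsC1 (0 : F)) addnC -[RHS](cardsID S); congr (_ + _)%N.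
apply: eq_card => x; rewrite !inE andbC.
by case: (x =P 0) => [->|]; rewrite ?andbT // (negbTE S0).
Qed.

Let roots_Q : all (root Q) (enum S).
Proof.
apply/allP => x; rewrite mem_enum => xS.
have x0 : x != 0 by apply: contraNneq S0 => <-.
by rewrite /root horner_Q // mulf_eq0 root_P xS orbT.
Qed.

(** [T] is nonempty and [Q] does not vanish on it, so [Q] is nonzero and has more coefficients than
    its roots in [S]. *)
Lemma size_shift_gt : (#|S| < size Q)%N.
Proof.
have nzQ : Q != 0.
  have /card_gt0P[x] : (0 < #|T|)%N by rewrite -(ltn_add2r #|S|) card_nz_setD.
  rewrite in_T => /andP[xS x0]; apply: contraNneq xS => Q0.
  move: (horner_Q x x0); rewrite Q0 horner0 => /esym/eqP.
  by rewrite mulf_eq0 expf_eq0 (negbTE x0) andbF /= root_P.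
rewrite cardE; apply: (max_poly_roots nzQ); last exact: enum_uniq.
exact: roots_Q.
Qed.

(* The shifted polynomial vanishes on [S], so it has the degree of [P] exactly
   when it is a scalar multiple of [P]; comparing values on [T], the scalar is
   the common value of [x ^+ k]. *)
Lemma size_shift_le :
  (size Q <= #|S|.+1)%N <-> exists c, forall x, x \in T -> x ^+ k = c.
Proof.
split=> [szQ|[c cE]].
  have dvPQ : P %| Q.
    rewrite /P -big_enum; apply: uniq_roots_dvdp; last first.
      by rewrite uniq_rootsE enum_uniq.
    exact: roots_Q.
  have /eqp_eq PQ : P %= Q.
    by rewrite -(dvdp_size_eqp dvPQ) size_P eqn_leq size_shift_gt szQ.
  have P1 : lead_coef P = 1.
    by apply/eqP; rewrite /P; apply: monic_prod_XsubC.
  exists (lead_coef Q) => x; rewrite in_T => /andP[xS x0].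
  have := congr1 (horner^~ x) PQ; rewrite /= P1 scale1r hornerZ horner_Q //.
  by move/mulIf => <- //; rewrite root_P.
suff -> : Q = c *: P by rewrite -size_P size_scale_leq.
apply/eqP; rewrite -subr_eq0; apply/eqP/poly_eq0.
  rewrite (leq_trans (size_polyD _ _)) // geq_max size_Q size_polyN.
  by rewrite (leq_trans (size_scale_leq _ _)) // size_P.
move=> x x0; rewrite hornerD hornerN hornerZ horner_Q //.
have [xS|xS] := boolP (x \in S).
  by move: xS; rewrite -root_P => /eqP ->; rewrite !mulr0 subrr.
by rewrite cE ?subrr // in_T xS.
Qed.

End Univariate.

(** * Cosets in the unit group and constancy of powers *)

Lemma commute_unit (F : finFieldType) (u v : {unit F}) : commute u v.
Proof. by apply: val_inj; rewrite !FinRing.val_unitM mulrC. Qed.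

(** The exponent [#|H|] kills [H], hence is constant on its cosets. Conversely, elements with equal
    [k]-th powers differ by a [k]-th root of unity, so any element of [T] can serve as [gamma]. *)
Lemma sub_coset_constant_powerP (F : finFieldType) (T : {set F}) :
  0 \notin T -> (0 < #|T|)%N ->
  (exists (gamma : {unit F}) (H : {group {unit F}}),
     H \proper [set: {unit F}] /\
     T \subset [set FinRing.uval u | u in (gamma *: H)%g]) <->
  (exists2 k, (0 < k < #|F| - 1)%N & exists c, forall x, x \in T -> x ^+ k = c).
Proof.
move=> T0 /card_gt0P[g gT]; split=> [[gamma [H [prH subT]]]|].
  exists #|H|.
    by rewrite cardG_gt0 subn1 -card_finField_unit proper_card.
  exists (FinRing.uval gamma ^+ #|H|) => x /(subsetP subT)/imsetP[u].
  rewrite mem_lcoset => uH ->.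
  rewrite -!FinRing.val_unitX; congr FinRing.uval.
  rewrite -[u in LHS](mulKVg gamma) expgMn; last exact: commute_unit.
  by rewrite (expg_cardG uH) mulg1.
case=> k /andP[k_gt0 k_lt] [c cE].
have nz x : x \in T -> x \is a GRing.unit.
  by move=> xT; rewrite unitfE; apply: contraNneq T0 => <-.
pose gamma : {unit F} := FinRing.Unit (nz g gT).
pose H : {set {unit F}} := [set u | u ^+ k == 1]%g.
have gH : group_set H.
  apply/group_setP; split=> [|u v]; rewrite !inE ?expg1n //.
  by move=> /eqP uk /eqP vk; rewrite expgMn ?uk ?vk ?mulg1 //;
    apply: commute_unit.
exists gamma, (group gH); split.
  (* If [H] were the whole group, all [#|F| - 1] nonzero elements would be [k]-th roots of unity, of
     which there are at most [k]. *)
  rewrite properE subsetT /=; apply: contraL k_lt => /subsetP HT.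
  rewrite -leqNgt subn1 -(cardsC1 (0 : F)) cardE; apply: max_unity_roots;
    rewrite ?enum_uniq //.
  apply/allP => x; rewrite mem_enum !inE -unitfE => xU; apply/unity_rootP.
  move: (HT (FinRing.Unit xU) (in_setT _)); rewrite inE => /eqP/(congr1 val).
  by rewrite FinRing.val_unitX.
apply/subsetP => x xT; apply/imsetP; exists (FinRing.Unit (nz x xT)) => //.
rewrite mem_lcoset inE expgMn; last exact: commute_unit.
rewrite expgVn -eq_mulVg1; apply/eqP/val_inj.
by rewrite !FinRing.val_unitX /= !cE.
Qed.

(** * Comparison of products, and the equivalence in several variables *)

Lemma eq_prod_nat (I : finType) (a b : I -> nat) :
  (forall i, 0 < a i <= b i)%N -> (\prod_i b i <= \prod_i a i)%N -> a =1 b.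
Proof.
move=> ab le_ba i; apply/eqP; apply: contraLR le_ba => ne_i; rewrite -ltnNge.
(* The remaining product of the [a j] is positive, so a strict inequality at [i] survives
   multiplication. *)
rewrite (bigD1 i) // [ltnRHS](bigD1 i) //=.
set A := (\prod_(j | _) a j)%N; set B := (\prod_(j | _) b j)%N.
have A_gt0 : (0 < A)%N by apply: prodn_gt0 => j; case/andP: (ab j).
have leAB : (A <= B)%N by apply: leq_prod => j _; case/andP: (ab j).
have lt_i : (a i < b i)%N by rewrite ltn_neqAle ne_i; case/andP: (ab i).
by rewrite (leq_trans (n := (b i * A)%N)) ?ltn_pmul2r ?leq_mul2l ?leAB ?orbT.
Qed.

Theorem theorem7 (F : finFieldType) (q : nat) (hq : #|F| = q)
  (n : nat) (hn : (0 < n)%N)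
  (S : 'I_n -> {set F})
  (hS0 : forall i : 'I_n, 0 \notin S i)
  (hs : forall i : 'I_n, (0 < #|S i| < q - 1)%N)
  (hs' : ~ (forall i : 'I_n, #|S i| = (q - 2)%N)) :
  let T := fun i : 'I_n => [set~ (0 : F)] :\: S i in
  let m := (\prod_(i < n) #|T i|)%N in
  let P : {mpoly F[n]} := \prod_(i < n) \prod_(x in S i) ('X_i - x%:MP) in
  (exists k : 'X_{1..n},
     (forall i : 'I_n, (0 < k i < q - 1)%N) /\
     [predI msupp (mpoly_red q ('X_[k] * P)) & Umon q (m - 1) (n := n)] =i pred0)
  <->
  (forall i : 'I_n, exists (gamma : {unit F}) (H : {group {unit F}}),
     H \proper [set: {unit F}] /\
     T i \subset [set FinRing.uval u | u in (gamma *: H)%g]).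
Proof.
have q_gt1 : (1 < q)%N.
  by rewrite -subn_gt0; have /andP[/ltn_trans lt /lt] := hs (Ordinal hn).
move=> T m P.
pose p (k : 'X_{1..n}) i := 'X^(k i) * \prod_(x in S i) ('X - x%:P) : {poly F}.
pose Q k i := p k i %% ('X^(q - 1) - 1).
have pE k : 'X_[k] * P = \prod_(i < n) horner_alg ('X_i : {mpoly F[n]}) (p k i).
  rewrite mpolyXE_id /P -big_split; apply: eq_bigr => i _ /=.
  rewrite rmorphM rmorphXn rmorph_prod /= horner_algX; congr (_ * _).
  apply: eq_bigr => x _; rewrite rmorphB /= horner_algX horner_algC.
  by rewrite -mul_mpolyC mulr1.
have suppE k mu : (mu \in msupp (mpoly_red q ('X_[k] * P))) =
    [forall i, (Q k i)`_(mu i) != 0].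
  rewrite mcoeff_msupp pE mcoeff_mpoly_red_prod //.
  by apply/prodf_neq0/forallP => [nz i|nz i _]; apply: nz.
have sS i : (#|S i| < #|F| - 1)%N by rewrite hq; case/andP: (hs i).
have cT i : (q - 1 - #|S i| = #|T i|)%N.
  by rewrite -hq -(card_nz_setD _ _ (hS0 i)) addnK.
have T_gt0 i : (0 < #|T i|)%N by rewrite -cT subn_gt0 -hq.
have m_gt0 : (0 < m)%N by rewrite prodn_gt0.
have gtQ k i : (#|S i| < size (Q k i))%N.
  by have := size_shift_gt _ _ (k i) (hS0 i) (sS i); rewrite hq.
have leQ k i := size_shift_le _ _ (k i) (hS0 i) (sS i).
have T0 i : 0 \notin T i by rewrite !inE eqxx andbF.
split=> [[k [k_bnd kU]] i|cosets].
  apply/(sub_coset_constant_powerP _ _ (T0 i) (T_gt0 i)).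
  exists (k i); first by rewrite hq.
  apply/leQ; rewrite hq -/(Q k i).
  (* The degrees of the [Q k j]: a support monomial, since leading coefficients are nonzero. *)
  pose mu : 'X_{1..n} := [multinom (size (Q k j)).-1 | j < n].
  have mu_supp : mu \in msupp (mpoly_red q ('X_[k] * P)).
    rewrite suppE; apply/forallP => j; rewrite mnmE.
    by rewrite -lead_coefE lead_coef_eq0 -size_poly_gt0 (leq_trans _ (gtQ k j)).
  have mu_lt j : (mu j < q - 1)%N.
    rewrite mnmE prednK ?(leq_trans _ (gtQ k j)) //.
    by rewrite size_modp_Xn_sub_1 // subn_gt0.
  have le_m : (m <= \prod_(j < n) (q - 1 - mu j))%N.
    rewrite leqNgt; apply: contraFN (kU mu) => lt_m.
    rewrite !inE mu_supp /=; apply/andP; split; first exact/forallP.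
    by rewrite (subn1 m) -ltnS prednK.
  (* Each factor is at most [#|T j|] while the product is at least [m], so all these bounds are
     equalities. *)
  have mu_bnd j : (0 < q - 1 - mu j <= #|T j|)%N.
    rewrite subn_gt0 mu_lt -cT leq_sub2l // mnmE -ltnS prednK ?gtQ //.
    by rewrite (leq_trans _ (gtQ k j)).
  have := eq_prod_nat _ (fun j => q - 1 - mu j)%N (fun j => #|T j|)
    mu_bnd le_m i.
  rewrite -cT => /eqP; rewrite eqn_sub2lE ?(ltnW (mu_lt i)) //; last first.
    by rewrite ltnW // -hq.
  by rewrite mnmE => /eqP <-; apply: leqSpred.
(* The coordinates are independent, so the exponents can be chosen one at a time. *)
have /fin_all_exists2[k k_bnd kc] i :
    exists2 k, (0 < k < q - 1)%N &
      (size (('X^k * \prod_(x in S i) ('X - x%:P)) %% ('X^(q - 1) - 1)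
               : {poly F})%R <= #|S i|.+1)%N.
  have /(sub_coset_constant_powerP _ _ (T0 i) (T_gt0 i))[k k_bnd kc] :=
    cosets i.
  exists k; first by rewrite -hq.
  by have/size_shift_le := kc; rewrite hq; apply; rewrite ?hS0 // -?hq.
exists [multinom k i | i < n]; split=> [i|mu]; first by rewrite mnmE.
rewrite !inE suppE; apply/negP => /andP[/forallP nz /andP[/forallP mu_lt]].
rewrite leqNgt => /negP[]; rewrite subn1 prednK //.
(* A nonzero coefficient at [mu i] forces [mu i <= #|S i|], so every factor is at least [#|T i|]. *)
apply: leq_prod => i _; rewrite -cT leq_sub2l //.
rewrite -ltnS (leq_trans _ (kc i)) // ltnNge; apply: contra (nz i) => le_i.
by rewrite /Q /p mnmE nth_default.
Qed.
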